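(* Let $\mathfrak{R}=\mathbb{C}[a,b,c,d,e,f]^H$ be the invariant ring of the group $H\subset GL(6,\mathbb{C})$ given in the context. Then the symmetrized weight enumerators $\mathscr{W}_{(\mathscr{E}_8,\mathscr{Q}_8)}$ and $\mathscr{W}_{(\mathscr{E}_8,\mathscr{K}_8)}$ form a basis of the $\mathbb{C}$-vector space of homogeneous elements of degree 8 of $\mathfrak{R}$.
   Context: **The group.** Let $i=\sqrt{-1}$ and $z=e^{2\pi i/8}$. The group $H=\langle X,P_1,P_2,E_1,E_2,zI_6\rangle\subset GL(6,\mathbb{C})$ is generated by the following matrices (rows and columns indexed in order by the variables $a,b,c,d,e,f$): $$X=\frac{z^3+z}{4}\begin{pmatrix}1&2&1&1&2&1\\1&0&-1&1&0&-1\\1&-2&1&1&-2&1\\1&2&1&-1&-2&-1\\1&0&-1&-1&0&1\\1&-2&1&-1&2&-1\end{pmatrix},$$ $$P_1=\begin{pmatrix}1&0&0&0&0&0\\0&0&0&0&1&0\\0&0&1&0&0&0\\0&0&0&1&0&0\\0&1&0&0&0&0\\0&0&0&0&0&1\end{pmatrix},\qquad P_2=z^2\begin{pmatrix}1&0&0&0&0&0\\0&0&0&0&1&0\\0&0&1&0&0&0\\0&0&0&0&0&1\\0&1&0&0&0&0\\0&0&0&1&0&0\end{pmatrix},$$ $$E_1=\mathrm{diag}(1,z,-1,z^2,-z^3,-z^2),\qquad E_2=\mathrm{diag}(1,z,-1,1,z,-1),$$ and $zI_6$, where $I_6$ is the identity matrix. A matrix $A=(A_{ij})\in GL(6,\mathbb{C})$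 acts on a polynomial $f(x_1,\dots,x_6)$, where $(x_1,\dots,x_6)=(a,b,c,d,e,f)$, by $A\cdot f(x_1,\dots,x_6)=f\left(\sum_j A_{1j}x_j,\dots,\sum_j A_{6j}x_j\right)$. The invariant ring $\mathbb{C}[a,b,c,d,e,f]^H$ consists of the polynomials fixed by every element of $H$, graded by total degree. **Symmetrized weight enumerators.** A linear code of length $n$ over $\mathbb{F}_2=\mathbb{Z}/2\mathbb{Z}$ (resp. $\mathbb{Z}_4=\mathbb{Z}/4\mathbb{Z}$) is an additive subgroup of $\mathbb{F}_2^n$ (resp. $\mathbb{Z}_4^n$); the rows of a generator matrix generate it as an additive group. Let $R=\mathbb{F}_2\times\mathbb{Z}_4$ and let $\bar R$ be the quotient of $R$ by the relation $r\sim s\Leftrightarrow r=s$ or $r=-s$. It has six classes, with representatives $(0,0),(0,1),(0,2),(1,0),(1,1),(1,2)$, to which the variables $a,b,c,d,e,f$ are attached in this order (so $(0,3)\sim(0,1)$ gets $b$ and $(1,3)\sim(1,1)$ gets $e$). Denote by $x_{\bar r}$ the variable attached to the class $\bar r$. For linear codes $\mathscr{C}_1\subset\mathbb{F}_2^n$ and $\mathscr{C}_2\subset\mathbb{Z}_4^n$, $$\mathscr{W}_{(\mathscr{C}_1,\mathscr{C}_2)}=\sum_{u\in\mathscr{C}_1,\,v\in\mathscr{C}_2}\ \prod_{\bar r\in\bar R}x_{\bar r}^{\,n_{\bar r}(u,v)},$$ where $n_{\bar r}(u,v)$ is the number of coordinates $j\in\{1,\dots,n\}$ with $\overline{(u_j,v_j)}=\bar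 r$. **The codes.** $\mathscr{E}_8\subset\mathbb{F}_2^8$ and $\mathscr{Q}_8,\mathscr{K}_8\subset\mathbb{Z}_4^8$ are the linear codes with generator matrices $$\mathscr{E}_8:\begin{pmatrix}1&1&1&1&0&0&0&0\\0&0&1&1&1&1&0&0\\0&0&0&0&1&1&1&1\\1&0&1&0&1&0&1&0\end{pmatrix},\quad \mathscr{Q}_8:\begin{pmatrix}0&0&1&1&0&2&1&3\\0&0&0&2&1&3&1&1\\1&1&0&2&0&0&1&3\\0&2&0&2&0&2&0&2\\0&0&0&0&0&0&2&2\end{pmatrix},$$ $$\mathscr{K}_8:\begin{pmatrix}1&1&1&1&1&1&1&1\\0&2&0&0&0&0&0&2\\0&0&2&0&0&0&0&2\\0&0&0&2&0&0&0&2\\0&0&0&0&2&0&0&2\\0&0&0&0&0&2&0&2\\0&0&0&0&0&0&2&2\end{pmatrix}.$$ *)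

(* Defs.v *)
From HB Require Import structures.
From mathcomp Require Import all_boot all_order all_fingroup all_algebra.
From mathcomp Require Import reals trigo.
From mathcomp Require Import complex.
From mathcomp Require Import mpoly.

Set Implicit Arguments.
Unset Strict Implicit.
Unset Printing Implicit Defensive.

Import GRing.Theory.
Local Open Scope ring_scope.

(* The subspace is given by its membership predicate [U]; the second clause
   says that the span of the family is exactly [U]. *)
Definition is_basis (K : nzRingType) (V : lmodType K) (U : V -> Prop)
    (k : nat) (s : k.-tuple V) : Prop :=
  (forall c : 'I_k -> K, \sum_(i < k) c i *: tnth s i = 0 -> forall i, c i = 0)
  /\ (forall v : V, U v <-> exists c : 'I_k -> K, v = \sum_(i < k) c i *: tnth s i).

(* Meant for sets [S] of invertible matrices: on those, [invmx] is the
   inverse (elsewhere it is the identity function). *)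
Inductive generated (K : fieldType) (n : nat) (S : 'M[K]_n -> Prop) :
    'M[K]_n -> Prop :=
| gen_one : generated S 1%:M
| gen_in A of S A : generated S A
| gen_mul A B of generated S A & generated S B : generated S (A *m B)
| gen_inv A of generated S A : generated S (invmx A).

Definition mx_act (K : fieldType) (n : nat) (A : 'M[K]_n) (f : {mpoly K[n]}) :
    {mpoly K[n]} :=
  f \mPo [tuple \sum_(j < n) A i j *: 'X_j | i < n].

Definition mx_invariant (K : fieldType) (n : nat) (G : 'M[K]_n -> Prop)
    (f : {mpoly K[n]}) : Prop :=
  forall A, G A -> mx_act A f = f.

Definition hom_invariant (K : fieldType) (n : nat) (G : 'M[K]_n -> Prop)
    (d : nat) (f : {mpoly K[n]}) : Prop :=
  f \is d.-homog /\ mx_invariant G f.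

Definition mx_of_rows (T : nmodType) (m n : nat) (rows : seq (seq T)) :
    'M[T]_(m, n) :=
  \matrix_(i < m, j < n) nth 0 (nth [::] rows i) j.

Definition diag_of_seq (T : pzRingType) (n : nat) (s : seq T) : 'M[T]_n :=
  diag_mx (\row_(j < n) nth 0 s j).

(* e^(2 pi i / 8), by Euler's formula *)
Definition zeta8 (R : realType) : R[i] :=
  (cos (2 * pi / 8) +i* sin (2 * pi / 8))%C.

Section Generators.
Variables (K : fieldType) (z : K).

Definition Xmx : 'M[K]_6 := ((z ^+ 3 + z) / 4) *: mx_of_rows 6 6
  [:: [:: 1;  2;  1;  1;  2;  1];
      [:: 1;  0; -1;  1;  0; -1];
      [:: 1; -2;  1;  1; -2;  1];
      [:: 1;  2;  1; -1; -2; -1];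
      [:: 1;  0; -1; -1;  0;  1];
      [:: 1; -2;  1; -1;  2; -1]].

Definition P1mx : 'M[K]_6 := mx_of_rows 6 6
  [:: [:: 1; 0; 0; 0; 0; 0];
      [:: 0; 0; 0; 0; 1; 0];
      [:: 0; 0; 1; 0; 0; 0];
      [:: 0; 0; 0; 1; 0; 0];
      [:: 0; 1; 0; 0; 0; 0];
      [:: 0; 0; 0; 0; 0; 1]].

Definition P2mx : 'M[K]_6 := z ^+ 2 *: mx_of_rows 6 6
  [:: [:: 1; 0; 0; 0; 0; 0];
      [:: 0; 0; 0; 0; 1; 0];
      [:: 0; 0; 1; 0; 0; 0];
      [:: 0; 0; 0; 0; 0; 1];
      [:: 0; 1; 0; 0; 0; 0];
      [:: 0; 0; 0; 1; 0; 0]].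

Definition E1mx : 'M[K]_6 :=
  diag_of_seq 6 [:: 1; z; -1; z ^+ 2; - z ^+ 3; - z ^+ 2].

Definition E2mx : 'M[K]_6 := diag_of_seq 6 [:: 1; z; -1; 1; z; -1].

Definition Hgens (A : 'M[K]_6) : Prop :=
  A \in [:: Xmx; P1mx; P2mx; E1mx; E2mx; z%:M].

End Generators.

Definition Hgroup (R : realType) : 'M[R[i]]_6 -> Prop :=
  generated (Hgens (zeta8 R)).

Definition letter : Type := ('F_2 * 'Z_4)%type.

Definition sim (r s : letter) : bool := (r == s) || (r == - s).

(* Representatives of the classes of [sim], in the order of the variables
   a, b, c, d, e, f. *)
Definition class_reps : 6.-tuple letter :=
  [tuple (0, 0); (0, 1); (0, 2); (1, 0); (1, 1); (1, 2)].

Lemma class_repsP (r : letter) : exists! k : 'I_6, sim r (tnth class_reps k).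
Proof.
have E : {k : 'I_6 | forall l : 'I_6, sim r (tnth class_reps l) = (l == k)}.
  case: r => -[[|[|//]] ?] [[|[|[|[|//]]]] ?];
    [exists (inord 0) | exists (inord 1) | exists (inord 2) | exists (inord 1)
    |exists (inord 3) | exists (inord 4) | exists (inord 5) | exists (inord 4)];
    by case=> -[|[|[|[|[|[|//]]]]]] ?; rewrite -[RHS]val_eqE /= inordK.
by case: E => k Hk; exists k; split=> [|l]; rewrite Hk // => /eqP.
Qed.

Definition class_count (n : nat) (k : 'I_6) (u : 'rV['F_2]_n) (v : 'rV['Z_4]_n) :
    nat :=
  #|[set j : 'I_n | sim (u 0 j, v 0 j) (tnth class_reps k)]|.

(* [{group _}] is the type of additive subgroups here: the group law of the
   finite type of row vectors is addition. *)
Definition swe (K : fieldType) (n : nat) (C1 : {group 'rV['F_2]_n})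
    (C2 : {group 'rV['Z_4]_n}) : {mpoly K[6]} :=
  \sum_(u in C1) \sum_(v in C2) \prod_(k < 6) 'X_k ^+ class_count k u v.

Definition code_of (T : finNzRingType) (m n : nat) (G : 'M[T]_(m, n)) :
    {group 'rV[T]_n} :=
  <<[set row i G | i : 'I_m]>>%G.

Definition code_E8 : {group 'rV['F_2]_8} := code_of (mx_of_rows 4 8
  [:: [:: 1; 1; 1; 1; 0; 0; 0; 0];
      [:: 0; 0; 1; 1; 1; 1; 0; 0];
      [:: 0; 0; 0; 0; 1; 1; 1; 1];
      [:: 1; 0; 1; 0; 1; 0; 1; 0]]).

Definition code_Q8 : {group 'rV['Z_4]_8} := code_of (mx_of_rows 5 8
  [:: [:: 0; 0; 1; 1; 0; 2; 1; 3];
      [:: 0; 0; 0; 2; 1; 3; 1; 1];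
      [:: 1; 1; 0; 2; 0; 0; 1; 3];
      [:: 0; 2; 0; 2; 0; 2; 0; 2];
      [:: 0; 0; 0; 0; 0; 0; 2; 2]]).

Definition code_K8 : {group 'rV['Z_4]_8} := code_of (mx_of_rows 7 8
  [:: [:: 1; 1; 1; 1; 1; 1; 1; 1];
      [:: 0; 2; 0; 0; 0; 0; 0; 2];
      [:: 0; 0; 2; 0; 0; 0; 0; 2];
      [:: 0; 0; 0; 2; 0; 0; 0; 2];
      [:: 0; 0; 0; 0; 2; 0; 0; 2];
      [:: 0; 0; 0; 0; 0; 2; 0; 2];
      [:: 0; 0; 0; 0; 0; 0; 2; 2]]).

(* Main.v *)
Require Import Defs.
From HB Require Import structures.
From mathcomp Require Import all_boot all_order all_fingroup all_algebra.
From mathcomp Require Import reals trigo.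
From mathcomp Require Import complex.
From mathcomp Require Import mpoly.
From mathcomp Require Import ring.

(** The monomial matrices of [H] kill all monomials of degree 8 but 38, which
    they permute in 11 orbits; these monomial matrices include [X D X] for
    suitable diagonal [D] in [H], because [X] is, up to a scalar, the tensor
    product of the 2x2 Hadamard matrix with its symmetric square. An invariant
    of degree 8 is thus a combination of 11 orbit sums. Evaluating the identity
    [f (X v) = f v] at nine integer points [v] expresses all the coefficients
    through those of [a ^ 8] and [b ^ 8], so that the space has dimension at
    most 2. Conversely every member of this two-parameter family is invariant,
    and enumerating the codes shows that the two weight enumerators are members
    of it with linearly independent parameters. *)

Set Implicit Arguments.
Unset Strict Implicit.
Unset Printing Implicit Defensive.
Import GRing.Theory Num.Theory.
Local Open Scope ring_scope.

(** * Codes spanned by integer rows *)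

(** Codewords are handled as lists of natural numbers, on which a code can be enumerated by
    evaluation; [natvec] carries them back to row vectors. *)
Definition natvec (T : pzRingType) (n : nat) (s : seq nat) : 'rV[T]_n :=
  \row_j (nth 0%N s j)%:R.

Definition addmul_mod (m k : nat) (g x : seq nat) : seq nat :=
  [seq (k * p.1 + p.2) %% m | p <- zip g x]%N.

(** Rows of order 2 modulo 4 and relations between rows produce a word several times, hence
    [undup]. *)
Fixpoint span_mod (m n : nat) (rows : seq (seq nat)) : seq (seq nat) :=
  if rows is g :: rows' then
    let S := span_mod m n rows' in
    undup [seq addmul_mod m k g x | k <- iota 0 m, x <- S]
  else [:: nseq n 0%N].

Lemma size_span_mod (m n : nat) (rows : seq (seq nat)) (s : seq nat) :
  all (fun g => size g == n) rows -> s \in span_mod m n rows -> size s = n.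
Proof.
elim: rows s => [|g rows IH] s /=; first by rewrite inE => _ /eqP->; rewrite size_nseq.
case/andP=> /eqP sg /IH{}IH; rewrite mem_undup => /allpairsP[[k x] /= [_ /IH sx ->]].
by rewrite size_map size_zip sg sx minnn.
Qed.

Lemma span_mod_lt (m n : nat) (rows : seq (seq nat)) (s : seq nat) :
  (0 < m)%N -> s \in span_mod m n rows -> all (fun a => a < m)%N s.
Proof.
move=> m0; case: rows => [|g rows] /=.
  by rewrite inE => /eqP->; rewrite all_nseq m0 orbT.
rewrite mem_undup => /allpairsP[[k x] /= [_ _ ->]].
by apply/allP=> _ /mapP[p _ ->]; rewrite ltn_mod.
Qed.

Lemma span_mod_uniq (m n : nat) (rows : seq (seq nat)) : uniq (span_mod m n rows).
Proof. by case: rows => //= g rows; apply: undup_uniq. Qed.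

(** In an abelian group the subgroup generated by [g] and [A] is the product of the two subgroups
    they generate. *)
Lemma mem_gen_setU1 (V : finZmodType) (g v : V) (A : {set V}) :
  v \in <<g |: A>>%g <-> exists k, exists2 w, w \in <<A>>%g & v = g *+ k + w.
Proof.
have -> : <<g |: A>>%g = (<[g]> * <<A>>)%g.
  rewrite -[LHS]/([set g] <*> A)%g -joing_idl -joing_idr cent_joinEl //.
  have ab := FinRing.zmod_abelian [set: V].
  exact: subset_trans (subset_trans (subsetT _) ab) (centS (subsetT _)).
split=> [/mulsgP[_ w /cycleP[k ->] wA ->]|[k [w wA ->]]].
  by exists k, w.
by apply/mulsgP; exists (g ^+ k)%g w => //; apply: mem_cycle.
Qed.

Section Span.
Variables (T : finNzRingType) (m n : nat).
Hypotheses (m_gt0 : (0 < m)%N) (char_m : m%:R = 0 :> T).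

Lemma natr_modn (a : nat) : (a %% m)%:R = a%:R :> T.
Proof. by rewrite [in RHS](divn_eq a m) natrD natrM char_m mulr0 add0r. Qed.

Lemma natvec_addmul (k : nat) (g x : seq nat) : size g = n -> size x = n ->
  natvec T n (addmul_mod m k g x) = natvec T n g *+ k + natvec T n x.
Proof.
move=> sg sx; apply/rowP=> j; rewrite !mxE mulmxnE !mxE.
rewrite (nth_map (0, 0)%N) ?size_zip ?sg ?sx ?minnn // natr_modn nth_zip ?sg //=.
by rewrite natrD mulnC natrM mulr_natr.
Qed.

Lemma natvec0 : natvec T n (nseq n 0%N) = 0.
Proof. by apply/rowP=> j; rewrite !mxE nth_nseq if_same. Qed.

Lemma mem_span_cons (g : seq nat) (rows : seq (seq nat)) (v : 'rV[T]_n) :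
  size g = n -> all (fun g => size g == n) rows ->
  v \in map (natvec T n) (span_mod m n (g :: rows)) <->
  exists k, exists2 w, w \in map (natvec T n) (span_mod m n rows)
    & v = natvec T n g *+ k + w.
Proof.
move=> sg srows; split.
  case/mapP=> s; rewrite mem_undup => /allpairsP[[k x] /= [_ xS ->]] ->.
  exists k, (natvec T n x); first exact: map_f.
  by rewrite natvec_addmul // (size_span_mod srows xS).
case=> k [_ /mapP[x xS ->] ->].
(* A multiple of [g] depends only on [k] modulo [m], and [span_mod] runs through the residues
   only. *)
have -> : natvec T n g *+ k = natvec T n g *+ (k %% m).
  by apply/rowP=> j; rewrite !mulmxnE -[LHS]mulr_natr -[RHS]mulr_natr natr_modn.
rewrite -natvec_addmul // ?(size_span_mod srows xS) //; apply: map_f.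
rewrite mem_undup; apply/allpairsP; exists ((k %% m)%N, x).
by rewrite mem_iota /= add0n ltn_mod.
Qed.

Lemma mem_span_mod (rows : seq (seq nat)) (v : 'rV[T]_n) :
  all (fun g => size g == n) rows ->
  (v \in map (natvec T n) (span_mod m n rows))
    = (v \in <<[set x in map (natvec T n) rows]>>%g).
Proof.
elim: rows v => [|g rows IH] v sz.
  by rewrite [[set x in _]]set_nil gen0 !inE natvec0.
have /andP[/eqP sg srows] := sz.
rewrite [map _ (g :: rows)]/= set_cons.
by apply/idP/idP; rewrite mem_gen_setU1 mem_span_cons // => -[k [w wS ->]];
  exists k, w; rewrite // -?IH // IH.
Qed.

End Span.

(** * Monomials as exponent sequences *)

Definition mnm_of (n : nat) (s : seq nat) : 'X_{1..n} := [multinom nth 0%N s i | i < n].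

Fixpoint compositions (n d : nat) : seq (seq nat) :=
  if n is n'.+1 then
    [seq k :: s | k <- iota 0 d.+1, s <- compositions n' (d - k)]
  else if d == 0 then [:: [::]] else [::].

Lemma mem_compositions (n d : nat) (s : seq nat) :
  (s \in compositions n d) = (size s == n) && (sumn s == d).
Proof.
elim: n d s => [|n IH] d s.
  by rewrite /=; case: eqP => [->|/eqP]; case: s => //= /negPf; rewrite eq_sym.
apply/allpairsPdep/andP => [[k [t [+ + ->]]]|[]].
  rewrite mem_iota IH add0n ltnS => /= kd /andP[/eqP-> /eqP->].
  by rewrite subnKC.
case: s => [//|k t] /eqP[st] /eqP ktd; exists k, t; split=> //.
  by rewrite mem_iota leq0n add0n ltnS -ktd /= leq_addr.
by rewrite IH st -ktd addKn !eqxx.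
Qed.

Lemma compositions_uniq (n d : nat) : uniq (compositions n d).
Proof.
elim: n d => [|n IH] d; first by rewrite /=; case: ifP.
by apply: allpairs_uniq_dep => [|k _|[k s] [l t] _ _ /= [-> ->]]; rewrite ?iota_uniq ?IH.
Qed.

Lemma mdeg_mnm_of (n : nat) (s : seq nat) : size s = n -> mdeg (mnm_of n s) = sumn s.
Proof.
move=> sz; rewrite mdegE sumnE (big_nth 0%N) sz big_mkord.
by apply: eq_bigr => i _; rewrite mnmE.
Qed.

Lemma mnm_of_codom (n : nat) (m : 'X_{1..n}) : mnm_of n [seq m i | i : 'I_n] = m.
Proof.
apply/mnmP=> i; rewrite mnmE (nth_map i) ?size_enum_ord // nth_ord_enum //.
Qed.

Lemma mnm_of_inj (n : nat) (s t : seq nat) :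
  size s = n -> size t = n -> mnm_of n s = mnm_of n t -> s = t.
Proof.
move=> ss st E; apply: (@eq_from_nth _ 0%N); rewrite ss ?st // => i ltin.
by have /mnmP/(_ (Ordinal ltin)) := E; rewrite !mnmE.
Qed.

(** The index set becomes an explicit list, which can be filtered and compared with orbits by
    evaluation. *)
Lemma dhomog_sum_compositions (K : nzRingType) (n d : nat) (f : {mpoly K[n]}) :
  f \is d.-homog ->
  f = \sum_(s <- compositions n d) f@_(mnm_of n s) *: 'X_[mnm_of n s].
Proof.
move=> fd; apply/mpolyP=> m; rewrite raddf_sum /=.
have comp_size s : s \in compositions n d -> size s = n /\ sumn s = d.
  by rewrite mem_compositions => /andP[/eqP-> /eqP->].
have [md|md] := eqVneq (mdeg m) d; last first.
  rewrite (dhomog_nemf_coeff fd md) big1_seq // => s /andP[_ /comp_size[ss sd]].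
  rewrite mcoeffZ mcoeffX; case: eqP => [E|]; last by rewrite mulr0.
  by rewrite -E mdeg_mnm_of // sd eqxx in md.
have [sz E] : size [seq m i | i : 'I_n] = n /\ mnm_of n [seq m i | i : 'I_n] = m.
  by rewrite size_map size_enum_ord mnm_of_codom.
move: [seq m i | i : _] sz E => s0 sz E.
have s0P : s0 \in compositions n d by rewrite mem_compositions sz -(mdeg_mnm_of sz) E md !eqxx.
rewrite (bigD1_seq s0) ?compositions_uniq //= mcoeffZ mcoeffX E eqxx mulr1.
rewrite big1_seq ?addr0 // => s /andP[ne /comp_size[ss _]].
rewrite mcoeffZ mcoeffX; case: eqP => [E'|]; last by rewrite mulr0.
by rewrite -E in E'; rewrite (mnm_of_inj ss sz E') eqxx in ne.
Qed.

Definition permute (l s : seq nat) : seq nat := [seq nth 0%N s i | i <- l].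

Lemma mcoeff_monomial_act (K : fieldType) (A : 'M[K]_6) (l : seq nat) (c : nat -> K)
    (f : {mpoly K[6]}) (s : seq nat) :
  perm_eq l (iota 0 6) -> permute l l = iota 0 6 ->
  (forall i j : 'I_6, A i j = if j == nth 0%N l i :> nat then c i else 0) ->
  (mx_act A f)@_(mnm_of 6 (permute l s))
    = (\prod_(i < 6) c i ^+ nth 0%N s i) * f@_(mnm_of 6 s).
Proof.
move=> pl ll Ac.
have szl : size l = 6 by rewrite (perm_size pl).
have ltl i : (i < 6)%N -> (nth 0%N l i < 6)%N.
  by move=> i6; have := mem_nth 0%N (_ : i < size l)%N;
    rewrite (perm_mem pl) mem_iota szl; apply.
pose t (i : 'I_6) : 'I_6 := Ordinal (ltl i (ltn_ord i)).
have tK : involutive t.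
  move=> i; apply: val_inj => /=; have := congr1 (nth 0%N ^~ i) ll.
  by rewrite /permute (nth_map 0%N) ?szl // nth_iota // add0n.
have perm_t (s' : seq nat) : mnm_of 6 (permute l s') = [multinom mnm_of 6 s' (t i) | i < 6].
  by apply/mnmP=> i; rewrite !mnmE (nth_map 0%N) ?szl.
have actX (m : 'X_{1..6}) :
    'X_[m] \mPo [tuple \sum_(j < 6) A i j *: 'X_j | i < 6] =
    (\prod_(i < 6) c i ^+ m i) *: 'X_[[multinom m (t i) | i < 6]].
  rewrite comp_mpolyX mpolyXE_id -mul_mpolyC rmorph_prod /=.
  rewrite [X in _ * X](reindex_inj (inv_inj tK)) -big_split /=.
  apply: eq_bigr => i _; rewrite mnmE tK tnth_mktuple (bigD1 (t i)) //= big1.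
    by rewrite addr0 Ac /= eqxx -mul_mpolyC exprMn rmorphXn.
  by move=> j; rewrite Ac -val_eqE /= => /negPf->; rewrite scale0r.
rewrite perm_t /mx_act comp_mpolyEX raddf_sum /=.
rewrite [in RHS](mpolyE f) raddf_sum /= mulr_sumr; apply: eq_bigr => m _.
rewrite actX !mcoeffZ !mcoeffX.
have -> : ([multinom m (t i) | i < 6] == [multinom mnm_of 6 s (t i) | i < 6])
    = (m == mnm_of 6 s).
  apply/eqP/eqP => [/mnmP E|->//]; apply/mnmP=> i.
  by have := E (t i); rewrite !mnmE tK.
case: eqP => [->|_]; last by rewrite !mulr0.
rewrite !mulr1 mulrC; congr (_ * _).
by apply: eq_bigr => i _; rewrite mnmE.
Qed.

(** * Matrix action and monomial elements of the group *)

Section Action.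
Variables (K : fieldType) (n : nat).
Implicit Types (A B : 'M[K]_n) (f : {mpoly K[n]}) (S : 'M[K]_n -> Prop).

Lemma mx_act1 f : mx_act 1%:M f = f.
Proof.
rewrite -[RHS]comp_mpoly_id; congr (_ \mPo _); apply: eq_mktuple => i.
rewrite (bigD1 i) //= big1 => [|j ji]; first by rewrite mxE eqxx scale1r addr0.
by rewrite mxE eq_sym (negPf ji) scale0r.
Qed.

(** Substitution is a right action: replacing [x] by [A x] and then [x] by [B x] gives
    [f (A (B x))]. *)
Lemma mx_actM A B f : mx_act (A *m B) f = mx_act B (mx_act A f).
Proof.
rewrite /mx_act [RHS](_ : _ = f \mPo [tuple (\sum_(j < n) A i j *: 'X_j) \mPo
    [tuple \sum_(j < n) B i j *: 'X_j | i < n] | i < n]); last first.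
  rewrite [X in X \mPo _ = _]comp_mpolyEX [RHS]comp_mpolyEX raddf_sum /=.
  apply: eq_bigr => m _; rewrite comp_mpolyZ !comp_mpolyX rmorph_prod /=.
  by congr (_ *: _); apply: eq_bigr => i _; rewrite rmorphXn !tnth_mktuple.
congr (_ \mPo _); apply: eq_mktuple => i; rewrite raddf_sum /=.
under [RHS]eq_bigr => j _ do rewrite comp_mpolyZ comp_mpolyXU -tnth_nth tnth_mktuple scaler_sumr.
rewrite exchange_big; apply: eq_bigr => k _; rewrite mxE scaler_suml.
by apply: eq_bigr => j _; rewrite scalerA.
Qed.

Lemma mx_invariant_generated S f :
  (forall A, S A -> mx_act A f = f) -> mx_invariant (Defs.generated S) f.
Proof.
move=> Sf A; elim=> {A} [|//|A B _ IHA _ IHB|A _ IHA].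
- exact: mx_act1.
- by rewrite mx_actM IHA.
(* Outside [unitmx], [invmx] is the identity and the induction hypothesis is already the claim. *)
have [uA|nuA] := boolP (A \in unitmx); last by rewrite (invmx_out nuA).
by rewrite -[in LHS]IHA -mx_actM mulmxV ?mx_act1.
Qed.

End Action.

Lemma big_ord6 (T : Type) (idx : T) (op : Monoid.law idx) (F : 'I_6 -> T) :
  \big[op/idx]_(i < 6) F i =
    op (F (@Ordinal 6 0 isT)) (op (F (@Ordinal 6 1 isT)) (op (F (@Ordinal 6 2 isT))
      (op (F (@Ordinal 6 3 isT)) (op (F (@Ordinal 6 4 isT)) (F (@Ordinal 6 5 isT)))))).
Proof.
rewrite !big_ord_recl big_ord0 Monoid.mulm1.
by do !congr (op _ _); congr F; apply: val_inj.
Qed.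

Lemma ord6_ind (P : 'I_6 -> Prop) :
  P (@Ordinal 6 0 isT) -> P (@Ordinal 6 1 isT) -> P (@Ordinal 6 2 isT) ->
  P (@Ordinal 6 3 isT) -> P (@Ordinal 6 4 isT) -> P (@Ordinal 6 5 isT) ->
  forall i, P i.
Proof.
move=> P0 P1 P2 P3 P4 P5 [[|[|[|[|[|[|//]]]]]] lt];
  by rewrite (bool_irrelevance lt isT).
Qed.

Section GroupElements.
Variables (K : numFieldType) (z : K).
Hypothesis z4 : z ^+ 4 = -1.

Lemma diag_of_seqM (s t : seq K) : size s = 6 -> size t = 6 ->
  diag_of_seq 6 s *m diag_of_seq 6 t = diag_of_seq 6 [seq p.1 * p.2 | p <- zip s t].
Proof.
move=> ss st; rewrite /diag_of_seq mulmx_diag; congr diag_mx; apply/rowP=> i.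
by rewrite !mxE (nth_map (0, 0)) ?size_zip ?ss ?st // nth_zip ?ss.
Qed.

(** The fourth power of [E1mx]. *)
Lemma generated_diag1 : Defs.generated (Hgens z) (diag_of_seq 6 [:: 1; -1; 1; 1; -1; 1]).
Proof.
have E1 : Defs.generated (Hgens z) (E1mx z) by apply: gen_in; rewrite /Hgens !inE eqxx !orbT.
have E2 := gen_mul E1 E1; have := gen_mul E2 E2.
rewrite /E1mx !diag_of_seqM //=; congr (Defs.generated _ (diag_of_seq _ _)).
by do !congr cons; ring: z4.
Qed.

(** The square of [E1mx] times the sixth power of [E2mx]. *)
Lemma generated_diag2 : Defs.generated (Hgens z) (diag_of_seq 6 [:: 1; 1; 1; -1; -1; -1]).
Proof.
have E1 : Defs.generated (Hgens z) (E1mx z) by apply: gen_in; rewrite /Hgens !inE eqxx !orbT.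
have E2 : Defs.generated (Hgens z) (E2mx z) by apply: gen_in; rewrite /Hgens !inE eqxx !orbT.
have E22 := gen_mul E2 E2.
have := gen_mul (gen_mul E1 E1) (gen_mul (gen_mul E22 E22) E22).
rewrite /E1mx /E2mx !diag_of_seqM //=; congr (Defs.generated _ (diag_of_seq _ _)).
by do !congr cons; ring: z4.
Qed.

(** [Xmx] without its scalar: with integer entries, products with diagonal matrices can be checked
    by evaluation. *)
Definition X0mx : 'M[int]_6 := mx_of_rows 6 6
  [:: [:: 1;  2;  1;  1;  2;  1];
      [:: 1;  0; -1;  1;  0; -1];
      [:: 1; -2;  1;  1; -2;  1];
      [:: 1;  2;  1; -1; -2; -1];
      [:: 1;  0; -1; -1;  0;  1];
      [:: 1; -2;  1; -1;  2; -1]].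

Lemma XmxE : Xmx z = ((z ^+ 3 + z) / 4) *: map_mx intr X0mx.
Proof.
congr (_ *: _); apply/matrixP=> i j.
by rewrite !mxE; elim/ord6_ind: i; elim/ord6_ind: j.
Qed.

Lemma Xmx_diag_Xmx (d : seq int) (l : seq nat) (i j : 'I_6) :
  X0mx *m diag_of_seq 6 d *m X0mx = \matrix_(i, j) (8 *+ (j == nth 0%N l i :> nat)) ->
  (Xmx z *m diag_of_seq 6 (map intr d) *m Xmx z) i j =
    if j == nth 0%N l i :> nat then -1 else 0.
Proof.
(* [(z^3 + z)^2 = z^6 + 2 z^4 + z^2 = -2], because [z^6 = - z^2]. *)
move=> XdX; have s2 : ((z ^+ 3 + z) / 4) * ((z ^+ 3 + z) / 4) = - 8^-1 by field: z4.
have -> : diag_of_seq 6 (map intr d) = map_mx intr (diag_of_seq 6 d) :> 'M[K]_6.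
  rewrite map_diag_mx; congr diag_mx; apply/rowP=> k; rewrite !mxE.
  have [kd|kd] := ltnP k (size d); first by rewrite (nth_map 0).
  by rewrite !nth_default ?size_map.
rewrite XmxE -!(scalemxAl, scalemxAr) scalerA s2 -!map_mxM XdX !mxE.
by case: eqP => _; rewrite ?mulr0 // mulNr mulVf ?pnatr_eq0.
Qed.

(** The symmetric square of [diag(1, -1)] acts on each half of the variables; its Hadamard
    conjugate, the symmetric square of a swap, exchanges [a] with [c] and [d] with [f]. *)
Lemma Xmx_diag1_Xmx (i j : 'I_6) :
  (Xmx z *m diag_of_seq 6 [:: 1; -1; 1; 1; -1; 1] *m Xmx z) i j =
    if j == nth 0%N [:: 2; 1; 0; 5; 4; 3]%N i :> nat then -1 else 0.
Proof.
apply: (Xmx_diag_Xmx (d := [:: 1; -1; 1; 1; -1; 1])); apply/matrixP=> {}i {}j.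
rewrite mul_mx_diag mxE mxE big_ord6.
by elim/ord6_ind: i; elim/ord6_ind: j; rewrite !mxE.
Qed.

(** Here [diag(1, -1)] sits in the binary tensor factor, and its Hadamard conjugate exchanges
    [a, b, c] with [d, e, f]. *)
Lemma Xmx_diag2_Xmx (i j : 'I_6) :
  (Xmx z *m diag_of_seq 6 [:: 1; 1; 1; -1; -1; -1] *m Xmx z) i j =
    if j == nth 0%N [:: 3; 4; 5; 0; 1; 2]%N i :> nat then -1 else 0.
Proof.
apply: (Xmx_diag_Xmx (d := [:: 1; 1; 1; -1; -1; -1])); apply/matrixP=> {}i {}j.
rewrite mul_mx_diag mxE mxE big_ord6.
by elim/ord6_ind: i; elim/ord6_ind: j; rewrite !mxE.
Qed.

Lemma P1mx_monomial (i j : 'I_6) : P1mx K i j =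
  if j == nth 0%N [:: 0; 4; 2; 3; 1; 5]%N i :> nat then 1 else 0.
Proof. by elim/ord6_ind: i; elim/ord6_ind: j; rewrite mxE. Qed.

Lemma P2mx_monomial (i j : 'I_6) : P2mx z i j =
  if j == nth 0%N [:: 0; 4; 2; 5; 1; 3]%N i :> nat then z ^+ 2 else 0.
Proof. by elim/ord6_ind: i; elim/ord6_ind: j; rewrite !mxE /= ?mulr0 ?mulr1. Qed.

(** With [-1 = z ^+ 4] every diagonal entry is a power of [z], so the scaling of a monomial is
    recorded by an exponent modulo 8. *)
Lemma E1mx_monomial (i j : 'I_6) : E1mx z i j =
  if j == nth 0%N (iota 0 6) i :> nat then
    z ^+ nth 0%N [:: 0; 1; 4; 2; 7; 6]%N i else 0.
Proof.
elim/ord6_ind: i; elim/ord6_ind: j; rewrite !mxE //= ?mulr1n ?mulr0n ?expr0 ?z4 //.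
  by rewrite (exprD z 4 3) z4 mulN1r.
by rewrite (exprD z 4 2) z4 mulN1r.
Qed.

Lemma E2mx_monomial (i j : 'I_6) : E2mx z i j =
  if j == nth 0%N (iota 0 6) i :> nat then
    z ^+ nth 0%N [:: 0; 1; 4; 0; 1; 4]%N i else 0.
Proof.
by elim/ord6_ind: i; elim/ord6_ind: j; rewrite !mxE //= ?mulr1n ?mulr0n ?expr0 ?z4.
Qed.

(** The order of [z] divides 8 but not 4, since [z ^+ 4 = -1] differs from 1; hence it is 8. *)
Lemma expz_eq1 (k : nat) : (z ^+ k == 1) = (8 %| k)%N.
Proof.
have z8 : z ^+ 8 = 1 by rewrite (exprM z 4 2) z4 sqrrN expr1n.
have [m zm] := prim_order_exists (isT : (0 < 8)%N) z8.
rewrite -(prim_order_dvd zm) => m8; suff -> : m = 8 by [].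
have n4 : ~~ (m %| 4)%N by rewrite (prim_order_dvd zm) z4 eq_sym -addr_eq0 -(natrD _ 1 1) pnatr_eq0.
have m_le8 : (m < 9)%N := dvdn_leq (isT : 0 < 8)%N m8.
by case: {zm} m m_le8 m8 n4 => [|[|[|[|[|[|[|[|[|m]]]]]]]]].
Qed.

End GroupElements.

(** * Invariants as combinations of orbit sums *)

(** The permutations underlying [P1mx], [P2mx] and the two products [Xmx D Xmx]. *)
Definition orbit_perms : seq (seq nat) :=
  [:: [:: 0; 4; 2; 3; 1; 5]; [:: 0; 4; 2; 5; 1; 3];
      [:: 2; 1; 0; 5; 4; 3]; [:: 3; 4; 5; 0; 1; 2]]%N.

(* Five rounds of closure exhaust the orbits of [orbit_reps]: their completeness
   is what [diag_fixed_orbits] checks. *)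
Definition exponent_orbit (r : seq nat) : seq (seq nat) :=
  iter 5 (fun S => undup (S ++ [seq permute l s | l <- orbit_perms, s <- S])) [:: r].

(** The order fixes the numbering of the coefficients from here on: number 0 belongs to [a ^ 8],
    number 1 to [b ^ 8]. *)
Definition orbit_reps : seq (seq nat) :=
  [:: [:: 8; 0; 0; 0; 0; 0]; [:: 0; 8; 0; 0; 0; 0]; [:: 3; 4; 1; 0; 0; 0];
      [:: 6; 0; 2; 0; 0; 0]; [:: 4; 0; 4; 0; 0; 0]; [:: 4; 0; 0; 4; 0; 0];
      [:: 4; 0; 0; 2; 0; 2]; [:: 2; 2; 0; 1; 2; 1]; [:: 0; 4; 0; 0; 4; 0];
      [:: 3; 0; 1; 3; 0; 1]; [:: 2; 0; 2; 2; 0; 2]]%N.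

(** The exponent of [z] by which the diagonal matrix with entries [z ^+ w_i] scales the monomial
    [s]. *)
Definition diag_phase (w s : seq nat) : nat := sumn [seq p.1 * p.2 | p <- zip w s]%N.

(* The last condition is invariance under the conjugate of [E1mx] by [P1mx]. *)
Definition diag_fixed (s : seq nat) : bool :=
  [&& 8 %| diag_phase [:: 0; 1; 4; 2; 7; 6] s, 8 %| diag_phase [:: 0; 1; 4; 0; 1; 4] s
    & 8 %| diag_phase [:: 0; 1; 4; 2; 7; 6] (permute [:: 0; 4; 2; 3; 1; 5] s)]%N.

(** The left list has no repetition, so this also says that the orbits are pairwise disjoint. *)
Lemma diag_fixed_orbits :
  perm_eq [seq s <- compositions 6 8 | diag_fixed s]
    (flatten [seq exponent_orbit r | r <- orbit_reps]).
Proof. by vm_compute. Qed.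

Lemma prod_expr_mnm_of (K : comNzRingType) (x : K) (s : seq nat) :
  size s = 6 -> \prod_(i < 6) x ^+ nth 0%N s i = x ^+ sumn s.
Proof.
move=> /mdeg_mnm_of <-; rewrite mdegE.
by rewrite (big_morph _ (exprD x) (expr0 x)); apply: eq_bigr => i _; rewrite mnmE.
Qed.

Section Invariants.
Variables (K : numFieldType) (z : K) (f : {mpoly K[6]}).
Hypotheses (z4 : z ^+ 4 = -1) (f_hom : f \is 8.-homog).
Hypothesis f_inv : mx_invariant (Defs.generated (Hgens z)) f.

Lemma permute_composition (l s : seq nat) :
  l \in orbit_perms -> s \in compositions 6 8 -> permute l s \in compositions 6 8.
Proof.
rewrite !mem_compositions => lP /andP[/eqP ss /eqP sd].
have pl : perm_eq l (iota 0 6) by apply/(allP (a := fun l => perm_eq l (iota 0 6))): lP.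
rewrite size_map (perm_size pl) size_iota eqxx /= -sd (perm_sumn (perm_map _ pl)).
by rewrite -ss -/(mkseq _ _) mkseq_nth.
Qed.

(** Each permutation occurs in the group up to a scalar 1, [z ^+ 2] or -1, whose eighth power is 1;
    in degree 8 it disappears. *)
Lemma mcoeff_permute (l s : seq nat) :
  l \in orbit_perms -> s \in compositions 6 8 ->
  f@_(mnm_of 6 (permute l s)) = f@_(mnm_of 6 s).
Proof.
move=> lP; rewrite mem_compositions => /andP[/eqP ss /eqP sd].
have scalar_phase (A : 'M[K]_6) (x : K) : x ^+ 8 = 1 ->
    Defs.generated (Hgens z) A -> perm_eq l (iota 0 6) -> permute l l = iota 0 6 ->
    (forall i j : 'I_6, A i j = if j == nth 0%N l i :> nat then x else 0) ->
    f@_(mnm_of 6 (permute l s)) = f@_(mnm_of 6 s).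
  move=> x8 HA pl ll Ax.
  rewrite -{1}(f_inv HA) (mcoeff_monomial_act (c := fun=> x) f s pl ll) //.
  by rewrite prod_expr_mnm_of // sd x8 mul1r.
have HX : Defs.generated (Hgens z) (Xmx z) by apply: gen_in; rewrite /Hgens inE eqxx.
move: lP scalar_phase; rewrite !inE => /or4P[] /eqP-> H.
- apply: (H (P1mx K) 1) => //; first by rewrite expr1n.
    by apply: gen_in; rewrite /Hgens !inE eqxx !orbT.
  exact: P1mx_monomial.
- apply: (H (P2mx z) (z ^+ 2)) => //.
  + by rewrite -exprM (exprM z 4 4) z4 -signr_odd.
  + by apply: gen_in; rewrite /Hgens !inE eqxx !orbT.
  + exact: P2mx_monomial.
- apply: (H _ (-1)) (Xmx_diag1_Xmx z4) => //; first by rewrite -signr_odd.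
  exact: gen_mul (gen_mul HX (generated_diag1 z4)) HX.
apply: (H _ (-1)) (Xmx_diag2_Xmx z4) => //; first by rewrite -signr_odd.
exact: gen_mul (gen_mul HX (generated_diag2 z4)) HX.
Qed.

(** By invariance the coefficient equals itself times a power of [z] other than 1. *)
Lemma mcoeff_diag_phase (A : 'M[K]_6) (w s : seq nat) :
  Defs.generated (Hgens z) A -> size w = 6 -> size s = 6 ->
  (forall i j : 'I_6, A i j =
    if j == nth 0%N (iota 0 6) i :> nat then z ^+ nth 0%N w i else 0) ->
  ~~ (8 %| diag_phase w s)%N -> f@_(mnm_of 6 s) = 0.
Proof.
move=> HA sw ss Aw nw; apply/eqP.
have permute_id : permute (iota 0 6) s = s by rewrite -[RHS](mkseq_nth 0%N) ss.
have := mcoeff_monomial_act (c := fun i => z ^+ nth 0%N w i) f s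
  (perm_refl _) (erefl : permute (iota 0 6) (iota 0 6) = iota 0 6) Aw.
rewrite (f_inv HA) permute_id.
rewrite (_ : \prod_(i < 6) _ = z ^+ diag_phase w s); last first.
  rewrite /diag_phase sumnE big_map (big_nth (0, 0)%N) size_zip sw ss big_mkord.
  rewrite (big_morph _ (exprD z) (expr0 z)); apply: eq_bigr => i _.
  by rewrite nth_zip ?sw //= exprM.
move/eqP; rewrite -subr_eq0 -{1}[f@__]mul1r -mulrBl mulf_eq0 subr_eq0 eq_sym expz_eq1 //.
by rewrite (negPf nw).
Qed.

Lemma mcoeff_orbit (r s : seq nat) : r \in compositions 6 8 ->
  s \in exponent_orbit r -> f@_(mnm_of 6 s) = f@_(mnm_of 6 r).
Proof.
move=> rP; rewrite /exponent_orbit; set k := 5%N.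
(* The claim holds after any number [k] of rounds, by induction. *)
suff H : {in iter k (fun S => undup (S ++ [seq permute l s | l <- orbit_perms, s <- S]))
    [:: r], forall s, s \in compositions 6 8 /\ f@_(mnm_of 6 s) = f@_(mnm_of 6 r)}.
  by case/H.
elim: k => [|k IH] t; first by rewrite inE => /eqP->.
rewrite iterS mem_undup mem_cat => /orP[/IH//|].
case/allpairsP=> -[l x] [lP /IH[xP xr] ->].
by rewrite permute_composition // mcoeff_permute.
Qed.

Lemma invariant_orbit_sum :
  f = \sum_(r <- orbit_reps) f@_(mnm_of 6 r) *: \sum_(s <- exponent_orbit r) 'X_[mnm_of 6 s].
Proof.
rewrite [LHS](dhomog_sum_compositions f_hom); set orbit_sum := RHS.
rewrite (bigID diag_fixed) /= [X in _ + X]big1_seq ?addr0; last first.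
  move=> s /andP[]; rewrite !negb_and => ns sP.
  have E1s t : t \in compositions 6 8 ->
      ~~ (8 %| diag_phase [:: 0; 1; 4; 2; 7; 6] t)%N -> f@_(mnm_of 6 t) = 0.
    rewrite mem_compositions => /andP[/eqP st _].
    apply: (mcoeff_diag_phase _ _ st (E1mx_monomial z4)) => //.
    by apply: gen_in; rewrite /Hgens !inE eqxx !orbT.
  have E2s t : t \in compositions 6 8 ->
      ~~ (8 %| diag_phase [:: 0; 1; 4; 0; 1; 4] t)%N -> f@_(mnm_of 6 t) = 0.
    rewrite mem_compositions => /andP[/eqP st _].
    apply: (mcoeff_diag_phase _ _ st (E2mx_monomial z4)) => //.
    by apply: gen_in; rewrite /Hgens !inE eqxx !orbT.
  case/or3P: ns => ns; rewrite ?(E1s s sP ns) ?(E2s s sP ns) ?scale0r //.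
  (* Only the third condition fails here: [P1mx] carries the coefficient to the permuted exponent,
     where [E1mx] kills it. *)
  have lP : [:: 0; 4; 2; 3; 1; 5]%N \in orbit_perms by [].
  by rewrite -(mcoeff_permute lP sP) E1s ?scale0r ?permute_composition.
rewrite {}/orbit_sum -big_filter (perm_big _ diag_fixed_orbits) big_flatten big_map.
apply: eq_big_seq => r rP; rewrite scaler_sumr; apply: eq_big_seq => s sP.
rewrite (mcoeff_orbit _ sP) // mem_compositions.
by apply/(allP (a := fun r => (size r == 6) && (sumn r == 8)%N)): rP.
Qed.

End Invariants.

(** * Weight enumerators *)

(** [span_mod] lists each codeword once: it has no duplicates, and residues below [m] stay distinct
    in [T]. *)
Lemma sum_code_of (T : finNzRingType) (m n p : nat) (rows : seq (seq nat)) (V : nmodType)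
    (F : 'rV[T]_n -> V) :
  (0 < m)%N -> m%:R = 0 :> T -> {in gtn m &, injective (fun a : nat => a%:R : T)} ->
  size rows = p -> all (fun g => size g == n) rows ->
  \sum_(v in code_of (mx_of_rows p n [seq [seq a%:R | a : nat <- g] | g <- rows])) F v
    = \sum_(s <- span_mod m n rows) F (natvec T n s).
Proof.
move=> m0 cm inj szp sz.
rewrite -(big_map (natvec T n) xpredT F) big_uniq /=; last first.
  rewrite map_inj_in_uniq ?span_mod_uniq // => s t sS tS /rowP E.
  have [ss st] := (size_span_mod sz sS, size_span_mod sz tS).
  apply: (@eq_from_nth _ 0%N); rewrite ss ?st // => i ltin.
  have := E (Ordinal ltin); rewrite !mxE /=; apply: inj; rewrite inE.
    by apply: (allP (span_mod_lt m0 sS)); rewrite mem_nth ?ss.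
  by apply: (allP (span_mod_lt m0 tS)); rewrite mem_nth ?st.
apply: eq_bigl => v; rewrite (mem_span_mod m0 cm) //; congr (v \in <<_>>%g).
apply/setP=> x; rewrite inE; apply/imsetP/mapP => [[i _ ->]|[g gR ->]].
  exists (nth [::] rows i); first by rewrite mem_nth ?szp.
  apply/rowP=> j; rewrite !mxE (nth_map [::]) ?szp // (nth_map 0%N) //.
  by rewrite (eqP (allP sz _ _)) ?mem_nth ?szp.
have ltgp : (index g rows < p)%N by rewrite -szp index_mem.
exists (Ordinal ltgp) => //; apply/rowP=> j.
rewrite !mxE (nth_map [::]) ?szp //= nth_index // (nth_map 0%N) //.
by rewrite (eqP (allP sz _ gR)).
Qed.

(** Each binary digit has three variables; the table sends 3 to the class of 1 because [3 = -1]
    modulo 4. *)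
Definition letter_class (a b : nat) : nat := (3 * a + nth 0 [:: 0; 1; 2; 1] b)%N.

Definition class_counts (n : nat) (s t : seq nat) : seq nat :=
  let cs := [seq letter_class (nth 0 s j) (nth 0 t j) | j <- iota 0 n]%N in
  [seq count_mem k cs | k <- iota 0 6].

Lemma sim_letter_class (a b : nat) (k : 'I_6) : (a < 2)%N -> (b < 4)%N ->
  sim (a%:R, b%:R) (tnth class_reps k) = (letter_class a b == k).
Proof.
by case: a => [|[|//]]; case: b => [|[|[|[|//]]]] _ _; elim/ord6_ind: k.
Qed.

Lemma class_count_natvec (n : nat) (s t : seq nat) (k : 'I_6) :
  size s = n -> size t = n -> all (gtn 2) s -> all (gtn 4) t ->
  class_count k (natvec _ n s) (natvec _ n t) = nth 0%N (class_counts n s t) k.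
Proof.
move=> ss st s2 t4.
rewrite /class_counts (nth_map 0%N) ?size_iota // nth_iota // add0n count_map.
rewrite /class_count -sum1_card -sum1_count.
have -> : iota 0 n = index_iota 0 n by rewrite /index_iota subn0.
rewrite big_mkord.
apply: eq_bigl => j; rewrite inE !mxE sim_letter_class //.
  by apply: (allP s2); rewrite mem_nth ?ss.
by apply: (allP t4); rewrite mem_nth ?st.
Qed.

Lemma big_tally (V : nmodType) (T : eqType) (s : seq T) (F : T -> V) :
  \sum_(x <- s) F x = \sum_(b <- tally s) F b.1 *+ b.2.
Proof.
rewrite -(perm_big _ (tallyK s)) big_flatten big_map; apply: eq_bigr => b _.
by rewrite big_nseq iter_addr_0.
Qed.

(** The last hypothesis is the part left to evaluation. Zero coefficients are filtered out in it
    because [tally] records only the exponents that occur. *)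
Lemma swe_orbit_sum (K : fieldType) (p q : nat) (rows2 rows4 : seq (seq nat)) (c : seq nat) :
  size rows2 = p -> size rows4 = q ->
  all (fun g => size g == 8) rows2 -> all (fun g => size g == 8) rows4 ->
  perm_eq (tally [seq class_counts 8 s t | s <- span_mod 2 8 rows2, t <- span_mod 4 8 rows4])
    [seq b <- [seq (s, rc.2) | rc <- zip orbit_reps c, s <- exponent_orbit rc.1] | b.2 != 0]%N ->
  swe K (code_of (mx_of_rows p 8 [seq [seq a%:R | a : nat <- g] | g <- rows2]))
        (code_of (mx_of_rows q 8 [seq [seq a%:R | a : nat <- g] | g <- rows4]))
    = \sum_(rc <- zip orbit_reps c) (\sum_(s <- exponent_orbit rc.1) 'X_[mnm_of 6 s]) *+ rc.2.
Proof.
move=> szp szq sz2 sz4 tallyE.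
transitivity (\sum_(e <- [seq class_counts 8 s t | s <- span_mod 2 8 rows2,
    t <- span_mod 4 8 rows4]) 'X_[mnm_of 6 e] : {mpoly K[6]}).
  have char2 : 2%:R = 0 :> 'F_2 by apply: val_inj.
  have inj2 : {in gtn 2 &, injective (fun a : nat => a%:R : 'F_2)}.
    by move=> [|[|a]] [|[|b]].
  have char4 : 4%:R = 0 :> 'Z_4 by apply: val_inj.
  have inj4 : {in gtn 4 &, injective (fun a : nat => a%:R : 'Z_4)}.
    by move=> [|[|[|[|a]]]] [|[|[|[|b]]]].
  rewrite [RHS]big_allpairs_dep /swe (sum_code_of _ _ char2 inj2 szp sz2) //.
  apply: eq_big_seq => s sS; rewrite (sum_code_of _ _ char4 inj4 szq sz4) //.
  apply: eq_big_seq => t tS; rewrite mpolyXE_id; apply: eq_bigr => k _.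
  rewrite mnmE class_count_natvec //.
  - exact: size_span_mod sS.
  - exact: size_span_mod tS.
  - exact: span_mod_lt sS.
  exact: span_mod_lt tS.
rewrite big_tally (perm_big _ tallyE) big_filter big_mkcond /=.
rewrite big_allpairs_dep /=; apply: eq_bigr => rc _; rewrite -sumrMnl; apply: eq_bigr => s _ /=.
by case: eqP => //= ->.
Qed.

Definition E8_rows : seq (seq nat) :=
  [:: [:: 1; 1; 1; 1; 0; 0; 0; 0];
      [:: 0; 0; 1; 1; 1; 1; 0; 0];
      [:: 0; 0; 0; 0; 1; 1; 1; 1];
      [:: 1; 0; 1; 0; 1; 0; 1; 0]]%N.

Lemma code_E8E :
  code_E8 = code_of (mx_of_rows 4 8 [seq [seq a%:R : 'F_2 | a : nat <- g] | g <- E8_rows]).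
Proof. by congr (code_of (mx_of_rows _ _ _)); rewrite /= ?mulr1n ?mulr0n. Qed.

Definition Q8_rows : seq (seq nat) :=
  [:: [:: 0; 0; 1; 1; 0; 2; 1; 3];
      [:: 0; 0; 0; 2; 1; 3; 1; 1];
      [:: 1; 1; 0; 2; 0; 0; 1; 3];
      [:: 0; 2; 0; 2; 0; 2; 0; 2];
      [:: 0; 0; 0; 0; 0; 0; 2; 2]]%N.

Lemma code_Q8E :
  code_Q8 = code_of (mx_of_rows 5 8 [seq [seq a%:R : 'Z_4 | a : nat <- g] | g <- Q8_rows]).
Proof. by congr (code_of (mx_of_rows _ _ _)); rewrite /= ?mulr1n ?mulr0n. Qed.

Definition K8_rows : seq (seq nat) :=
  [:: [:: 1; 1; 1; 1; 1; 1; 1; 1];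
      [:: 0; 2; 0; 0; 0; 0; 0; 2];
      [:: 0; 0; 2; 0; 0; 0; 0; 2];
      [:: 0; 0; 0; 2; 0; 0; 0; 2];
      [:: 0; 0; 0; 0; 2; 0; 0; 2];
      [:: 0; 0; 0; 0; 0; 2; 0; 2];
      [:: 0; 0; 0; 0; 0; 0; 2; 2]]%N.

Lemma code_K8E :
  code_K8 = code_of (mx_of_rows 7 8 [seq [seq a%:R : 'Z_4 | a : nat <- g] | g <- K8_rows]).
Proof. by congr (code_of (mx_of_rows _ _ _)); rewrite /= ?mulr1n ?mulr0n. Qed.

(** The evaluation runs over 16 times 256 pairs of codewords; the coefficients follow the order of
    [orbit_reps]. *)
Lemma swe_E8_Q8 (K : fieldType) : swe K code_E8 code_Q8 =
  \sum_(rc <- zip orbit_reps [:: 1; 32; 96; 4; 22; 14; 12; 576; 448; 32; 216]%N)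
    (\sum_(s <- exponent_orbit rc.1) 'X_[mnm_of 6 s]) *+ rc.2.
Proof. by rewrite code_E8E code_Q8E; apply: swe_orbit_sum; vm_compute. Qed.

Lemma swe_E8_K8 (K : fieldType) : swe K code_E8 code_K8 =
  \sum_(rc <- zip orbit_reps [:: 1; 128; 0; 28; 70; 14; 84; 0; 1792; 224; 504]%N)
    (\sum_(s <- exponent_orbit rc.1) 'X_[mnm_of 6 s]) *+ rc.2.
Proof. by rewrite code_E8E code_K8E; apply: swe_orbit_sum; vm_compute. Qed.

(** * The relations imposed by [Xmx] *)

(** The combination of the eleven orbit sums, factored and over any ring, so that one formula serves
    both for points, where relations are evaluated, and for the variables. *)
Definition orbit_poly (T : pzRingType) (c x : nat -> T) : T :=
  c 0%N * (x 0%N ^+ 8 + x 2%N ^+ 8 + x 3%N ^+ 8 + x 5%N ^+ 8)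
  + c 1%N * (x 1%N ^+ 8 + x 4%N ^+ 8)
  + c 2%N * ((x 0%N * x 2%N * (x 0%N ^+ 2 + x 2%N ^+ 2) + x 3%N * x 5%N * (x 3%N ^+ 2 + x 5%N ^+ 2))
           * (x 1%N ^+ 4 + x 4%N ^+ 4))
  + c 3%N * (x 0%N ^+ 6 * x 2%N ^+ 2 + x 0%N ^+ 2 * x 2%N ^+ 6
           + x 3%N ^+ 6 * x 5%N ^+ 2 + x 3%N ^+ 2 * x 5%N ^+ 6)
  + c 4%N * (x 0%N ^+ 4 * x 2%N ^+ 4 + x 3%N ^+ 4 * x 5%N ^+ 4)
  + c 5%N * ((x 0%N ^+ 4 + x 2%N ^+ 4) * (x 3%N ^+ 4 + x 5%N ^+ 4))
  + c 6%N * ((x 0%N ^+ 4 + x 2%N ^+ 4) * x 3%N ^+ 2 * x 5%N ^+ 2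
           + x 0%N ^+ 2 * x 2%N ^+ 2 * (x 3%N ^+ 4 + x 5%N ^+ 4))
  + c 7%N * (x 1%N ^+ 2 * x 4%N ^+ 2
           * ((x 0%N ^+ 2 + x 2%N ^+ 2) * x 3%N * x 5%N
              + (x 3%N ^+ 2 + x 5%N ^+ 2) * x 0%N * x 2%N))
  + c 8%N * (x 1%N ^+ 4 * x 4%N ^+ 4)
  + c 9%N * (x 0%N * x 2%N * (x 0%N ^+ 2 + x 2%N ^+ 2)
             * (x 3%N * x 5%N * (x 3%N ^+ 2 + x 5%N ^+ 2)))
  + c 10%N * (x 0%N ^+ 2 * x 2%N ^+ 2 * x 3%N ^+ 2 * x 5%N ^+ 2).

Lemma rmorph_orbit_poly (T U : pzRingType) (h : {rmorphism T -> U}) (c x : nat -> T) :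
  h (orbit_poly c x) = orbit_poly (h \o c) (h \o x).
Proof. by rewrite /orbit_poly !(rmorphD, rmorphM, rmorphXn). Qed.

Lemma eq_orbit_poly (T : pzRingType) (c d x y : nat -> T) :
  (forall k, (k < 11)%N -> c k = d k) -> (forall k, (k < 6)%N -> x k = y k) ->
  orbit_poly c x = orbit_poly d y.
Proof. by move=> cd xy; rewrite /orbit_poly !cd // !xy. Qed.

Definition X0_image (T : pzRingType) (x : nat -> T) : nat -> T :=
  nth 0 [:: x 0%N + 2 * x 1%N + x 2%N + x 3%N + 2 * x 4%N + x 5%N;
            x 0%N - x 2%N + x 3%N - x 5%N;
            x 0%N - 2 * x 1%N + x 2%N + x 3%N - 2 * x 4%N + x 5%N;
            x 0%N + 2 * x 1%N + x 2%N - x 3%N - 2 * x 4%N - x 5%N;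
            x 0%N - x 2%N - x 3%N + x 5%N;
            x 0%N - 2 * x 1%N + x 2%N - x 3%N + 2 * x 4%N - x 5%N].

(* Coefficients, on the orbit sums, of the invariants of degree 8 with
   [a ^+ 8]-coefficient [u] and [b ^+ 8]-coefficient [4 * t]. *)
Definition inv_coefs (T : pzRingType) (u t : T) : nat -> T :=
  nth 0 [:: u; 4 * t; 128 * u - 4 * t; t - 4 * u; 6 * u + 2 * t; 14 * u;
            3 * t - 12 * u; 768 * u - 24 * t; 56 * t; 8 * t - 32 * u; 120 * u + 12 * t].

Lemma rmorph_inv_coefs (T U : pzRingType) (h : {rmorphism T -> U}) (u t : T) (k : nat) :
  h (inv_coefs u t k) = inv_coefs (h u) (h t) k.
Proof.
by do 11![case: k => [|k]; rewrite /inv_coefs /=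
  ?(rmorphD, rmorphN, rmorphM, rmorph_nat) //]; case: k => [|k] /=; rewrite rmorph0.
Qed.

(** The scalar of [Xmx] has square -1/8 and eighth power 1/4096: this is invariance under [Xmx] with
    denominators cleared. *)
Lemma orbit_poly_X0 (T : comNzRingType) (u t : T) (x : nat -> T) :
  orbit_poly (inv_coefs u t) (X0_image x) = 4096 * orbit_poly (inv_coefs u t) x.
Proof. rewrite /orbit_poly /inv_coefs /X0_image /=; ring. Qed.

Lemma orbit_polyZ (T : comNzRingType) (a : T) (c x : nat -> T) :
  orbit_poly c (fun k => a * x k) = a ^+ 8 * orbit_poly c x.
Proof. rewrite /orbit_poly; ring. Qed.

(* Nine independent linear relations between the eleven coefficients, solved by
   exhibiting each coefficient as an explicit combination of the vanishing
   [defect]s. *)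
Lemma orbit_poly_X0_coefs (K : numFieldType) (c : nat -> K) :
  (forall x, orbit_poly c (X0_image x) = 4096 * orbit_poly c x) ->
  forall k, (k < 11)%N -> c k = inv_coefs (c 0%N) (c 1%N / 4) k.
Proof.
move=> cX.
pose defect (s : seq K) :=
  (orbit_poly c (X0_image (nth 0 s)) - 4096 * orbit_poly c (nth 0 s)) / 256.
have defect0 s : defect s = 0 by rewrite /defect cX subrr mul0r.
(* Entries 0, 1 and -1 keep the relations short. The factor 256 in [p8] undoes the division in
   [defect]. *)
pose p1 := defect [:: 0; 1; 0; 0; 0; 0]; pose p2 := defect [:: 1; 0; 1; 0; 0; 0].
pose p3 := defect [:: 1; 0; 0; 1; 0; 0]; pose p4 := defect [:: 1; 0; -1; 0; 0; 0].
pose p5 := defect [:: 1; 0; 1; 1; 0; -1]; pose p6 := defect [:: 1; 1; 0; 1; 0; 0].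
pose p7 := defect [:: 1; 1; 1; 1; 0; -1]; pose p8 := 256 * defect [:: 1; 0; 0; 0; 0; 0].
pose p9 := defect [:: 1; 1; 0; 1; 1; 0].
have p0 : (p1, p2, p3, p4, p5, p6, p7, p8, p9) = (0, 0, 0, 0, 0, 0, 0, 0, 0).
  by rewrite /p1 /p2 /p3 /p4 /p5 /p6 /p7 /p8 /p9 !defect0 mulr0.
case: p0 => p10 p20 p30 p40 p50 p60 p70 p80 p90.
(* The added combinations come from solving the linear system; once [p1] to [p9] are unfolded, each
   identity holds for arbitrary [c]. *)
have c2 : c 2 = 128 * c 0%N - c 1%N
    + (- 2 * p1 + 2 * p2 + 16 * p3 - p4 - p5 + p7 + p8) / 32.
  by rewrite /p1 /p2 /p3 /p4 /p5 /p6 /p7 /p8 /p9 /defect /orbit_poly /X0_image /=; field.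
have c3 : c 3 = c 1%N / 4 - 4 * c 0%N
    + (9 * p1 - 9 * p2 + 15 * p3 + 15 * p4 - p5 + p7 + p8 + p9) / 576.
  by rewrite /p1 /p2 /p3 /p4 /p5 /p6 /p7 /p8 /p9 /defect /orbit_poly /X0_image /=; field.
have c4 : c 4 = 6 * c 0%N + c 1%N / 2
    + (9 * p1 - 9 * p2 - 15 * p3 - 15 * p4 + p5 - p7 - p8 - p9) / 288.
  by rewrite /p1 /p2 /p3 /p4 /p5 /p6 /p7 /p8 /p9 /defect /orbit_poly /X0_image /=; field.
have c5 : c 5 = 14 * c 0%N
    + (- p1 + p2 - p4 - p5 + p7 + p8) / 256.
  by rewrite /p1 /p2 /p3 /p4 /p5 /p6 /p7 /p8 /p9 /defect /orbit_poly /X0_image /=; field.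
have c6 : c 6 = 3 * c 1%N / 4 - 12 * c 0%N
    + (- p1 + p2 + 8 * p3 + 8 * p6) / 128.
  by rewrite /p1 /p2 /p3 /p4 /p5 /p6 /p7 /p8 /p9 /defect /orbit_poly /X0_image /=; field.
have c7 : c 7 = 768 * c 0%N - 6 * c 1%N
    + (- 6 * p1 + 2 * p2 - 16 * p3 - 3 * p4 + p5 - p7 + 3 * p8) / 16.
  by rewrite /p1 /p2 /p3 /p4 /p5 /p6 /p7 /p8 /p9 /defect /orbit_poly /X0_image /=; field.
have c8 : c 8 = 14 * c 1%N + p1 - p2 + p4.
  by rewrite /p1 /p2 /p3 /p4 /p5 /p6 /p7 /p8 /p9 /defect /orbit_poly /X0_image /=; field.
have c9 : c 9 = 2 * c 1%N - 32 * c 0%N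
    + (16 * p1 + p5 - p8) / 128.
  by rewrite /p1 /p2 /p3 /p4 /p5 /p6 /p7 /p8 /p9 /defect /orbit_poly /X0_image /=; field.
have c10 : c 10 = 120 * c 0%N + 3 * c 1%N
    + (27 * p1 + 5 * p2 - 16 * p3 + p4 - p5 - 16 * p6 - p7 + p8) / 64.
  by rewrite /p1 /p2 /p3 /p4 /p5 /p6 /p7 /p8 /p9 /defect /orbit_poly /X0_image /=; field.
have eqs := (p10, p20, p30, p40, p50, p60, p70, p80, p90).
case=> [|[|[|[|[|[|[|[|[|[|[|k]]]]]]]]]]] // _; rewrite /inv_coefs /=; first by field.
all: by rewrite ?(c2, c3, c4, c5, c6, c7, c8, c9, c10) !eqs; field.
Qed.

(** * The two-parameter family of invariant polynomials *)

Definition mvars (K : nzRingType) : nat -> {mpoly K[6]} :=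
  nth 0 [:: 'X_(@Ordinal 6 0 isT); 'X_(@Ordinal 6 1 isT); 'X_(@Ordinal 6 2 isT);
            'X_(@Ordinal 6 3 isT); 'X_(@Ordinal 6 4 isT); 'X_(@Ordinal 6 5 isT)].

Lemma mpolyX_mnm_of (K : comNzRingType) (s : seq nat) : 'X_[mnm_of 6 s] =
  mvars K 0 ^+ nth 0%N s 0 * (mvars K 1 ^+ nth 0%N s 1 * (mvars K 2 ^+ nth 0%N s 2 *
  (mvars K 3 ^+ nth 0%N s 3 * (mvars K 4 ^+ nth 0%N s 4 * mvars K 5 ^+ nth 0%N s 5)))).
Proof. by rewrite mpolyXE_id big_ord6 !mnmE. Qed.

Lemma sum_orbits (K : comNzRingType) (c : nat -> K) :
  \sum_(0 <= k < 11) c k *: \sum_(s <- exponent_orbit (nth [::] orbit_reps k)) 'X_[mnm_of 6 s]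
    = orbit_poly (fun k => (c k)%:MP) (mvars K).
Proof.
have -> : \sum_(0 <= k < 11) c k *:
      \sum_(s <- exponent_orbit (nth [::] orbit_reps k)) 'X_[mnm_of 6 s]
    = \sum_(0 <= k < 11) c k *:
      \sum_(s <- nth [::] [seq exponent_orbit r | r <- orbit_reps] k) 'X_[mnm_of 6 s].
  by apply: eq_big_nat => k k11; rewrite (nth_map [::]).
(* The orbits form a closed term, evaluated here to explicit exponents; a polynomial identity
   remains. *)
set orbits := map _ _; vm_compute in (value of orbits).
rewrite unlock /= /orbits /= !mpolyX_mnm_of /= -!mul_mpolyC /orbit_poly.
ring.
Qed.

Lemma mx_act_orbit_poly (K : fieldType) (A : 'M[K]_6) (c : nat -> K)
    (y : nat -> {mpoly K[6]}) :
  (forall i : 'I_6, \sum_(j < 6) A i j *: 'X_j = y i) ->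
  mx_act A (orbit_poly (fun k => (c k)%:MP) (mvars K)) = orbit_poly (fun k => (c k)%:MP) y.
Proof.
move=> Ay; rewrite /mx_act rmorph_orbit_poly; apply: eq_orbit_poly => k lt /=.
  exact: comp_mpolyC.
pose i := Ordinal lt; rewrite -[k]/(val i) -Ay.
have -> : mvars K i = 'X_i by elim/ord6_ind: i.
by rewrite comp_mpolyXU -tnth_nth tnth_mktuple.
Qed.

Definition inv_poly (K : fieldType) (u t : K) : {mpoly K[6]} :=
  orbit_poly (fun k => (inv_coefs u t k)%:MP) (mvars K).

Section InvPoly.
Variables (K : numFieldType) (z : K).
Hypothesis z4 : z ^+ 4 = -1.

Lemma mx_act_Xmx (c : nat -> K) :
  4096 * mx_act (Xmx z) (orbit_poly (fun k => (c k)%:MP) (mvars K))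
    = orbit_poly (fun k => (c k)%:MP) (X0_image (mvars K)).
Proof.
pose s := (z ^+ 3 + z) / 4.
rewrite (@mx_act_orbit_poly _ _ c (fun k => s%:MP * X0_image (mvars K) k)); last first.
  move=> i; rewrite big_ord6; elim/ord6_ind: i; rewrite !mxE -/s /X0_image /mvars /=;
    rewrite -!mul_mpolyC !(rmorphM, rmorphN, rmorph1, rmorph0, rmorph_nat) /=; ring.
have s8K : 4096 * s ^+ 8 = 1 by rewrite /s; field: z4.
by rewrite orbit_polyZ mulrA -(rmorph_nat (@mpolyC 6 K)) -rmorphXn -rmorphM s8K rmorph1 mul1r.
Qed.

(** The generators suffice. All but [Xmx] are monomial, and the factored form of [orbit_poly] is
    checked on their substitutions using [z ^+ 4 = -1]. *)
Lemma inv_poly_invariant (u t : K) :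
  mx_invariant (Defs.generated (Hgens z)) (inv_poly u t).
Proof.
apply: mx_invariant_generated => A; rewrite /Hgens /inv_poly.
have Z4 : z%:MP_[6] ^+ 4 = -1 :> {mpoly K[6]} by rewrite -rmorphXn z4 rmorphN rmorph1.
have rowE (y : nat -> {mpoly K[6]}) :
    (forall i : 'I_6, \sum_(j < 6) (A i j)%:MP * 'X_j = y i) ->
    mx_act A (orbit_poly (fun k => (inv_coefs u t k)%:MP) (mvars K))
      = orbit_poly (fun k => (inv_coefs u t k)%:MP) y.
  move=> Ay; apply: mx_act_orbit_poly => i; rewrite -Ay.
  by apply: eq_bigr => j _; rewrite mul_mpolyC.
pose cE := (rmorphM, rmorphN, rmorphXn, rmorph1, rmorph0, rmorph_nat).
pose m := mvars K.
rewrite !inE => /orP[/eqP eqA|/or4P[/eqP eqA|/eqP eqA|/eqP eqA|/orP[]/eqP eqA]].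
(* For [Xmx] the parameters are moved into the polynomial ring, where [orbit_poly_X0] applies and
   4096 can be cancelled. *)
- have E x : orbit_poly (fun k => (inv_coefs u t k)%:MP) x
      = orbit_poly (inv_coefs u%:MP t%:MP) x :> {mpoly K[6]}.
    by apply: eq_orbit_poly => // k _; rewrite (rmorph_inv_coefs (@mpolyC 6 K)).
  have nz : 4096 != 0 :> {mpoly K[6]}.
    by rewrite -(rmorph_nat (@mpolyC 6 K)) mpolyC_eq0 pnatr_eq0.
  by apply: (mulfI nz); rewrite eqA mx_act_Xmx !E orbit_poly_X0.
- rewrite (rowE (nth 0 [:: m 0%N; m 4; m 2; m 3; m 1%N; m 5])).
    by rewrite /orbit_poly /m /=; ring.
  rewrite eqA => i; rewrite big_ord6.
  elim/ord6_ind: i; rewrite !mxE /m /mvars /= ?cE; ring.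
- rewrite (rowE (fun k => z%:MP ^+ 2 * nth 0 [:: m 0%N; m 4; m 2; m 5; m 1%N; m 3] k)).
    by rewrite /orbit_poly /m /=; ring: Z4.
  rewrite eqA => i; rewrite big_ord6.
  elim/ord6_ind: i; rewrite !mxE /m /mvars /= ?cE; ring.
- rewrite (rowE (nth 0 [:: m 0%N; z%:MP * m 1%N; - m 2; z%:MP ^+ 2 * m 3;
      - z%:MP ^+ 3 * m 4; - z%:MP ^+ 2 * m 5])).
    by rewrite /orbit_poly /m /=; ring: Z4.
  rewrite eqA => i; rewrite big_ord6.
  elim/ord6_ind: i; rewrite !mxE /m /mvars /= ?cE; ring.
- rewrite (rowE (nth 0 [:: m 0%N; z%:MP * m 1%N; - m 2; m 3; z%:MP * m 4; - m 5])).
    by rewrite /orbit_poly /m /=; ring: Z4.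
  rewrite eqA => i; rewrite big_ord6.
  elim/ord6_ind: i; rewrite !mxE /m /mvars /= ?cE; ring.
rewrite (rowE (fun k => z%:MP * m k)).
  by rewrite /orbit_poly /m /=; ring: Z4.
rewrite eqA => i; rewrite big_ord6.
elim/ord6_ind: i; rewrite !mxE /m /mvars /= ?cE; ring.
Qed.

End InvPoly.

Lemma rmorph_X0_image (T U : pzRingType) (h : {rmorphism T -> U}) (x : nat -> T) (k : nat) :
  h (X0_image x k) = X0_image (h \o x) k.
Proof.
by do 6![case: k => [|k]; rewrite /X0_image /=
  ?(rmorphD, rmorphN, rmorphM, rmorph_nat) //]; case: k => [|k] /=; rewrite rmorph0.
Qed.

Lemma meval_orbit_poly (K : comNzRingType) (c x : nat -> K) (y : nat -> {mpoly K[6]}) :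
  (orbit_poly (fun k => (c k)%:MP) y).@[fun i : 'I_6 => x i]
    = orbit_poly c (fun k => (y k).@[fun i : 'I_6 => x i]).
Proof.
by rewrite rmorph_orbit_poly; apply: eq_orbit_poly => k _ //=; rewrite mevalC.
Qed.

Lemma meval_mvars (K : comNzRingType) (x : nat -> K) (k : nat) :
  (k < 6)%N -> (mvars K k).@[fun i : 'I_6 => x i] = x k.
Proof. by case: k => [|[|[|[|[|[|]]]]]] // _; rewrite mevalXU. Qed.

Lemma sum_orbit_reps (K : comNzRingType) (c : seq nat -> K) :
  \sum_(r <- orbit_reps) c r *: \sum_(s <- exponent_orbit r) 'X_[mnm_of 6 s]
    = orbit_poly (fun k => (c (nth [::] orbit_reps k))%:MP) (mvars K).
Proof. by rewrite -(sum_orbits (fun k => c (nth [::] orbit_reps k))) (big_nth [::]). Qed.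

(** The degrees are read off from [diag_fixed_orbits], whose left side consists of compositions of
    8. *)
Lemma inv_poly_homog (K : fieldType) (u t : K) : inv_poly u t \is 8.-homog.
Proof.
rewrite /inv_poly -sum_orbits big_nat; apply: rpred_sum => k k11; apply: rpredZ.
rewrite big_seq; apply: rpred_sum => s sk; rewrite dhomogX.
have : s \in flatten [seq exponent_orbit r | r <- orbit_reps].
  apply/flatten_mapP; exists (nth [::] orbit_reps k) => //; exact: mem_nth.
rewrite -(perm_mem diag_fixed_orbits) mem_filter => /andP[_].
by rewrite mem_compositions => /andP[/eqP ss /eqP sd]; rewrite /= mdeg_mnm_of // sd.
Qed.

(** This bounds the dimension by 2: the diagonal and permutation symmetries leave eleven
    coefficients, and [Xmx] leaves two of them free. *)
Lemma invariant_inv_poly (K : numFieldType) (z : K) (f : {mpoly K[6]}) :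
  z ^+ 4 = -1 -> f \is 8.-homog -> mx_invariant (Defs.generated (Hgens z)) f ->
  exists u t, f = inv_poly u t.
Proof.
move=> z4 f8 f_inv.
have := invariant_orbit_sum z4 f8 f_inv; rewrite (sum_orbit_reps (fun r => f@_(mnm_of 6 r))).
set c := fun k => f@_(mnm_of 6 (nth [::] orbit_reps k)) => fE.
have fX : mx_act (Xmx z) f = f.
  by apply: f_inv; apply: gen_in; rewrite /Hgens inE eqxx.
exists (c 0%N), (c 1%N / 4); rewrite {1}fE /inv_poly.
apply: eq_orbit_poly => // k k11; congr _%:MP.
(* Evaluating the polynomial identity [mx_act_Xmx] at a point [x] gives the scalar relation
   required. *)
apply: orbit_poly_X0_coefs k11 => x.
have /(congr1 (meval (fun i : 'I_6 => x i))) := mx_act_Xmx z4 c.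
rewrite -fE fX fE rmorphM rmorph_nat !meval_orbit_poly => E.
transitivity (orbit_poly c (fun k => (X0_image (mvars K) k).@[fun i : 'I_6 => x i])).
  apply: eq_orbit_poly => // j _; rewrite (rmorph_X0_image (meval _)).
  by rewrite /X0_image /= !meval_mvars.
rewrite -E; congr (_ * _); rewrite [LHS]meval_orbit_poly.
by apply: eq_orbit_poly => // j j6; apply: meval_mvars.
Qed.

(** * The weight enumerators inside the family, and the basis *)

Lemma swe_inv_poly (K : fieldType) (c : seq nat) (u t : K) : size c = 11 ->
  (forall k, (k < 11)%N -> (nth 0%N c k)%:R = inv_coefs u t k) ->
  \sum_(rc <- zip orbit_reps c) (\sum_(s <- exponent_orbit rc.1) 'X_[mnm_of 6 s]) *+ rc.2
    = inv_poly u t.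
Proof.
move=> sc cE; rewrite /inv_poly -sum_orbits (big_nth ([::], 0%N)) size_zip sc.
rewrite big_nat [RHS]big_nat; apply: eq_bigr => k k11.
by rewrite nth_zip ?sc //= -cE // scaler_nat.
Qed.

(** The parameters are the [a ^ 8]-coefficient 1 and a quarter of the [b ^ 8]-coefficient 32. *)
Lemma swe_E8_Q8_inv_poly (K : fieldType) : swe K code_E8 code_Q8 = inv_poly 1 8.
Proof.
rewrite swe_E8_Q8; apply: swe_inv_poly => // k.
by do 11![case: k => [|k]; first by rewrite /inv_coefs /= => _; ring].
Qed.

Lemma swe_E8_K8_inv_poly (K : fieldType) : swe K code_E8 code_K8 = inv_poly 1 32.
Proof.
rewrite swe_E8_K8; apply: swe_inv_poly => // k.
by do 11![case: k => [|k]; first by rewrite /inv_coefs /= => _; ring].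
Qed.

Lemma inv_polyD (K : fieldType) (a b u t v w : K) :
  a *: inv_poly u t + b *: inv_poly v w = inv_poly (a * u + b * v) (a * t + b * w).
Proof.
rewrite /inv_poly -!mul_mpolyC.
have E p q : orbit_poly (fun k => (inv_coefs p q k)%:MP) (mvars K)
    = orbit_poly (inv_coefs p%:MP q%:MP) (mvars K) :> {mpoly K[6]}.
  by apply: eq_orbit_poly => // k _; rewrite (rmorph_inv_coefs (@mpolyC 6 K)).
rewrite !E !(rmorphD, rmorphM) /orbit_poly /inv_coefs /=; ring.
Qed.

(** The values at the first two unit vectors are [u] and [4 * t]. *)
Lemma inv_poly_eq0 (K : numFieldType) (u t : K) : inv_poly u t = 0 -> u = 0 /\ t = 0.
Proof.
move=> H; split.
  have := congr1 (meval (fun i : 'I_6 => nth 0 [:: 1] i)) H.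
  rewrite meval_orbit_poly meval0 /orbit_poly /inv_coefs !meval_mvars //= => E.
  by rewrite -[RHS]E; ring.
have := congr1 (meval (fun i : 'I_6 => nth 0 [:: 0; 1] i)) H.
rewrite meval_orbit_poly meval0 /orbit_poly /inv_coefs !meval_mvars //= => E.
have nz : 4 != 0 :> K by rewrite pnatr_eq0.
by apply: (mulfI nz); rewrite mulr0 -[RHS]E; ring.
Qed.

(** Squaring doubles the angle, and two doublings turn [2 * pi / 8] into [pi]. *)
Lemma zeta8_exp4 (R : realType) : zeta8 R ^+ 4 = -1.
Proof.
have sq (x : R) : (cos x +i* sin x)%C ^+ 2 = (cos (x + x) +i* sin (x + x))%C.
  rewrite expr2 cosD sinD; apply/eqP; rewrite eq_complex /= eqxx /=.
  by rewrite addrC [cos x * sin x]mulrC.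
rewrite /zeta8 (exprM _ 2 2) !sq (_ : _ + _ = pi); last by field.
by rewrite cospi sinpi; apply/eqP; rewrite eq_complex /= oppr0 !eqxx.
Qed.

Theorem theorem3p2 (R : realType) :
  is_basis (hom_invariant (@Hgroup R) 8)
    [tuple swe R[i] code_E8 code_Q8; swe R[i] code_E8 code_K8].
Proof.
have z4 := zeta8_exp4 R.
rewrite swe_E8_Q8_inv_poly swe_E8_K8_inv_poly.
have combE (c : 'I_2 -> R[i]) :
    \sum_(i < 2) c i *: tnth [tuple inv_poly 1 8; inv_poly 1 32] i
      = inv_poly (c ord0 + c ord_max) (c ord0 * 8 + c ord_max * 32) :> {mpoly R[i][6]}.
  rewrite big_ord_recl big_ord1 /= !(tnth_nth 0) /= inv_polyD !mulr1.
  by have -> : lift ord0 ord0 = ord_max :> 'I_2 by apply: val_inj.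
split=> [c|f].
  rewrite combE => /inv_poly_eq0[E1 E2] i.
  (* The parameter pairs (1, 8) and (1, 32) have determinant 24; subtracting 8 times the first
     equation from the second leaves [24 * c ord_max = 0]. *)
  have c1 : c ord_max = 0.
    have nz : 24 != 0 :> R[i] by rewrite pnatr_eq0.
    apply: (mulfI nz); rewrite mulr0 -[RHS](subrr (0 : R[i])) -{1}E2.
    by rewrite -[X in _ = _ - X](mulr0 8) -E1; ring.
  have c0 : c ord0 = 0 by move: E1; rewrite c1 addr0.
  by case: i => -[|[|//]] lt; [rewrite -[RHS]c0 | rewrite -[RHS]c1]; congr c; apply: val_inj.
split=> [[f8 f_inv]|[c ->]].
  have [u [t ->]] := invariant_inv_poly z4 f8 f_inv.
  (* The solution of [c0 + c1 = u] and [8 * c0 + 32 * c1 = t], with [c1 = b]. *)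
  pose b := (t - 8 * u) / 24; exists (fun i => if i == ord0 then u - b else b).
  have bE : (u - b) * 8 + b * 32 = t by rewrite /b; field.
  by rewrite combE /= subrK bE.
rewrite combE; split; first exact: inv_poly_homog.
exact: inv_poly_invariant z4 _ _.
Qed.
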